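(* Let $k\ge 1$ be an integer and let $c^k(n)$ be the number of $k$-compositions of $n$. The generating function for $c^k(n)$ is, as a formal power series, $$\sum_{n\ge 1} c^k(n)x^n=\frac{\sum_{i\ge 1}x^i}{1-k\sum_{i\ge 1}x^i}=\frac{x}{1-(k+1)x},$$ and $c^k(n)=(k+1)^{n-1}$ for every $n\ge 1$.
   Context: A composition of a positive integer $n$ is a finite ordered sequence of positive integers (parts) with sum $n$. For a positive integer $k$, a $k$-composition of $n$ is a composition of $n$ with either of the following equivalent modifications. (a) Colored parts: each part is assigned a color in $\{1,\dots,k\}$, except that the first part must have color 1. (b) Internal zeros: each (positive) part except the first may be immediately preceded by up to $k-1$ zeros. The two versions correspond by replacing each colored part $c_\ell$ with $\ell-1$ zeros followed by $c$. *)

(* Defs.v *)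
From HB Require Import structures.
From mathcomp Require Import all_boot all_order all_algebra.
From mathcomp Require Import finmap.
From mathcomp Require Import boolp classical_sets functions cardinality.

Set Implicit Arguments.
Unset Strict Implicit.
Unset Printing Implicit Defensive.

Import GRing.Theory.
Local Open Scope ring_scope.

Definition is_composition (n : nat) (s : seq nat) : bool :=
  all (fun p => 0 < p)%N s && (sumn s == n).

(* The list is read as (part, color), ...; the default value 1 of [head] is
   only used for the empty list, which is never a composition of a positive
   integer. *)
Definition is_kcomposition (k n : nat) (s : seq (nat * nat)) : bool :=
  [&& is_composition n (unzip1 s),
      all (fun c => 1 <= c <= k)%N (unzip2 s)
    & head 1%N (unzip2 s) == 1%N].

(* [fset_set] is empty on infinite sets, but a composition of n has at most n
   parts, all at most n, so the set of k-compositions of n is finite. *)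
Definition num_kcompositions (k n : nat) : nat :=
  #|` fset_set [set s | is_kcomposition k n s]%classic |.

(* The ring R[[x]] of formal power series, with the Cauchy product. *)
Record fps (R : Type) := Fps { fps_coef : nat -> R }.

HB.instance Definition _ (R : Type) := gen_eqMixin (fps R).
HB.instance Definition _ (R : Type) := gen_choiceMixin (fps R).

Lemma fpsP (R : Type) (f g : fps R) : fps_coef f =1 fps_coef g -> f = g.
Proof. by case: f g => [f] [g] /funext /= ->. Qed.

Section Zmodule.
Variable R : zmodType.
Implicit Types f g h : fps R.

Definition fps_zero : fps R := Fps (fun _ => 0).
Definition fps_opp f := Fps (fun n => - fps_coef f n).
Definition fps_add f g := Fps (fun n => fps_coef f n + fps_coef g n).

Lemma fps_addA : associative fps_add.
Proof. by move=> f g h; apply: fpsP => n /=; rewrite addrA. Qed.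
Lemma fps_addC : commutative fps_add.
Proof. by move=> f g; apply: fpsP => n /=; rewrite addrC. Qed.
Lemma fps_add0 : left_id fps_zero fps_add.
Proof. by move=> f; apply: fpsP => n /=; rewrite add0r. Qed.
Lemma fps_addN : left_inverse fps_zero fps_opp fps_add.
Proof. by move=> f; apply: fpsP => n /=; rewrite addNr. Qed.

HB.instance Definition _ :=
  GRing.isZmodule.Build (fps R) fps_addA fps_addC fps_add0 fps_addN.
End Zmodule.

Section ComRing.
Variable R : comNzRingType.
Implicit Types f g h : fps R.

Definition fps_one : fps R := Fps (fun n => (n == 0%N)%:R).
Definition fps_mul f g :=
  Fps (fun n => \sum_(i < n.+1) fps_coef f i * fps_coef g (n - i)%N).

Let trunc (N : nat) f : {poly R} := \poly_(i < N.+1) fps_coef f i.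

Let coef_trunc N f i : (i <= N)%N -> (trunc N f)`_i = fps_coef f i.
Proof. by move=> iN; rewrite coef_poly ltnS iN. Qed.

Let coef_mul N f g i : (i <= N)%N ->
  fps_coef (fps_mul f g) i = (trunc N f * trunc N g)`_i.
Proof.
move=> iN; rewrite coefM /=; apply: eq_bigr => j _.
rewrite !coef_trunc ?(leq_trans (leq_subr _ _)) //.
by rewrite (leq_trans _ iN) // -ltnS.
Qed.

Lemma fps_mulC : commutative fps_mul.
Proof.
by move=> f g; apply: fpsP => n; rewrite !(@coef_mul n) // mulrC.
Qed.
Lemma fps_mulA : associative fps_mul.
Proof.
move=> f g h; apply: fpsP => n.
have -> : fps_coef (fps_mul f (fps_mul g h)) n
          = (trunc n f * (trunc n g * trunc n h))`_n.
  rewrite coefM /=; apply: eq_bigr => j _.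
  by rewrite -(@coef_mul n) ?leq_subr // coef_trunc // -ltnS.
rewrite mulrA fps_mulC /= [_ * trunc n h]mulrC coefM.
apply: eq_bigr => j _.
by rewrite -(@coef_mul n) ?leq_subr // coef_trunc // -ltnS.
Qed.
Lemma fps_mul1 : left_id fps_one fps_mul.
Proof.
move=> f; apply: fpsP => n /=.
rewrite big_ord_recl /= mul1r subn0 big1 ?addr0 // => i _.
by rewrite mul0r.
Qed.
Lemma fps_mulDl : left_distributive fps_mul (@fps_add R).
Proof.
move=> f g h; apply: fpsP => n /=; rewrite -big_split /=.
by apply: eq_bigr => i _; rewrite mulrDl.
Qed.
Lemma fps_one_neq0 : fps_one != 0.
Proof.
apply/eqP => /(congr1 (fun f => fps_coef f 0%N)) /= /eqP.
by rewrite oner_eq0.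
Qed.

HB.instance Definition _ := GRing.Zmodule_isComNzRing.Build (fps R)
  fps_mulA fps_mulC fps_mul1 fps_mulDl fps_one_neq0.
End ComRing.

Section ComUnitRing.
Variable R : comUnitRingType.
Implicit Types f g h : fps R.

Definition fps_unit : {pred fps R} :=
  [pred f : fps R | fps_coef f 0%N \is a GRing.unit].

(* The first n+1 coefficients b_0, ..., b_n of the inverse of f, obtained from
   b_m = - f_0^-1 * \sum_(j < m) f_(m - j) * b_j. *)
Fixpoint fps_inv_seq f (n : nat) : seq R :=
  if n is m.+1 then
    let s := fps_inv_seq f m in
    rcons s (- (fps_coef f 0%N)^-1 *
               \sum_(j < m.+1) fps_coef f (m.+1 - j)%N * s`_j)
  else [:: (fps_coef f 0%N)^-1].

Definition fps_inv f : fps R :=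
  if f \in fps_unit then Fps (fun n => (fps_inv_seq f n)`_n) else f.

Lemma size_fps_inv_seq f n : size (fps_inv_seq f n) = n.+1.
Proof. by elim: n => //= n IH; rewrite size_rcons IH. Qed.

Lemma nth_fps_inv_seq f n i : (i <= n)%N ->
  (fps_inv_seq f n)`_i = (fps_inv_seq f i)`_i.
Proof.
elim: n => [|n IH]; first by rewrite leqn0 => /eqP->.
rewrite leq_eqVlt => /predU1P [-> //|]; rewrite ltnS => lein.
by rewrite /= nth_rcons size_fps_inv_seq ltnS lein IH.
Qed.

Lemma fps_mulVf : {in fps_unit, left_inverse 1 fps_inv *%R}.
Proof.
move=> f uf; rewrite /fps_inv uf; apply: fpsP => -[|n] /=.
  by rewrite big_ord1 /= mulVr.
rewrite big_ord_recr /= subnn nth_rcons size_fps_inv_seq ltnn eqxx.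
rewrite mulrAC mulNr mulVr // mulN1r; apply/eqP; rewrite subr_eq0; apply/eqP.
apply: eq_bigr => i _; rewrite mulrC /=.
by congr (_ * _); rewrite [RHS]nth_fps_inv_seq // -ltnS.
Qed.

Lemma fps_unitPl f g : g * f = 1 -> fps_unit f.
Proof.
move=> /(congr1 (fun h => fps_coef h 0%N)) /=.
by rewrite big_ord1 /= => gf1; apply/unitrPr; exists (fps_coef g 0%N); rewrite mulrC.
Qed.

Lemma fps_inv_out : {in [predC fps_unit], fps_inv =1 id}.
Proof. by move=> f; rewrite /fps_inv inE => /negPf->. Qed.

HB.instance Definition _ := GRing.ComNzRing_hasMulInverse.Build (fps R)
  fps_mulVf fps_unitPl fps_inv_out.
End ComUnitRing.

Definition fpsX (R : comNzRingType) : fps R := Fps (fun n => (n == 1%N)%:R).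

(* The formal series \sum_(i >= 1) a_i x^i. *)
Definition fps_sum_ge1 (R : comNzRingType) (a : nat -> R) : fps R :=
  Fps (fun i => if (1 <= i)%N then a i else 0).

(* Main.v *)
Require Import Defs.
From mathcomp Require Import all_boot all_order all_algebra.
From mathcomp Require Import finmap.
From mathcomp Require Import classical_sets cardinality.
Import GRing.Theory.
Local Open Scope ring_scope.

(** Every k-composition of [n + 2] arises exactly once from a k-composition of
    [n + 1], whose first part is [p] (of colour 1): either that part grows to
    [p + 1], or it receives one of the [k] colours and a new first part [1] is
    put before it. Which of these happened can be read off the result, because
    the first part is [1] only in the second case, and undoing the step is then
    unambiguous. So each step multiplies the number of k-compositions by
    [k + 1], and since [1] has a single k-composition, [n] has
    [(k + 1) ^ (n - 1)] of them ([num_kcompositionsS]).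

    The generating functions are then geometric series. Writing [G_a] for
    [\sum_(n >= 1) a ^ (n - 1) x ^ n], one has [G_a (1 - a x) = x]
    ([geometric_fps_mul]). The series [S = x + x ^ 2 + ...] is [G_1] and the
    generating function of k-compositions is [G_(k + 1)]. From [S (1 - x) = x],
    [1 - (k + 1) x = (1 - x) - k x = (1 - x) (1 - k S)]; cancelling the
    invertible factor [1 - x] turns [x / (1 - (k + 1) x)] into
    [S / (1 - k S)]. *)

(** The value [c = 0] encodes enlarging the first part, and a positive [c] is
    the colour that the former first part takes behind a new part [1]. *)
Definition kcomp_extend (s : seq (nat * nat)) (c : nat) : seq (nat * nat) :=
  if s is (p, _) :: t then
    if c is 0 then (p.+1, 1%N) :: t else [:: (1%N, 1%N), (p, c) & t]
  else [::].

Fixpoint kcomp_enum (k n : nat) : seq (seq (nat * nat)) :=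
  if n is m.+1 then
    [seq kcomp_extend s c | s <- kcomp_enum k m, c <- iota 0 k.+1]
  else [:: [:: (1%N, 1%N)]].

Lemma is_kcomposition_cons (k n p c : nat) (t : seq (nat * nat)) :
  is_kcomposition k n ((p, c) :: t) =
  [&& (0 < p)%N, c == 1%N, (1 <= k)%N, all (fun q => 0 < q)%N (unzip1 t),
      all (fun d => 1 <= d <= k)%N (unzip2 t) & (p + sumn (unzip1 t) == n)%N].
Proof.
rewrite /is_kcomposition /is_composition /=.
case: (c =P 1%N) => [->|_] /=; last by rewrite !andbF.
rewrite andbT; case: (0 < p)%N => //=.
by rewrite andbC -!andbA; congr (_ && _); rewrite andbCA.
Qed.

(** Extending keeps the first colour equal to 1 and raises the sum by one.
    Conversely a first part [p + 2] is the enlargement of [p + 1], and a first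
    part 1 of a sum at least 2 is followed by some part, whose colour tells
    which extension to undo. *)
Lemma mem_kcomp_enum (k n : nat) (hk : (1 <= k)%N) (s : seq (nat * nat)) :
  (s \in kcomp_enum k n) = is_kcomposition k n.+1 s.
Proof.
elim: n s => [|n IHn] s.
  rewrite inE; case: s => [|[p c] t] //.
  rewrite is_kcomposition_cons hk.
  apply/eqP/and5P => [[-> -> ->] //|[p_gt0 /eqP -> _ t_gt0]].
  case: t t_gt0 => [|[q d] t] /= => [_ /eqP|/andP [q_gt0 _] /andP [_ /eqP sum1]].
    by rewrite addn0 => ->.
  by have := leq_add p_gt0 (leq_add q_gt0 (leq0n (sumn (unzip1 t)))); rewrite sum1.
apply/allpairsP/idP => [[[s' c] []]|].
  rewrite mem_iota add0n ltnS IHn /= => s'_in c_le ->.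
  move: s'_in; case: s' => [//|[p d] t].
  rewrite is_kcomposition_cons => /and5P [p_gt0 _ _ t_gt0 /andP [t_col /eqP sum_t]].
  case: c c_le => [|c] c_le; rewrite /= is_kcomposition_cons hk /=.
    by rewrite t_gt0 t_col addSn sum_t /=.
  by rewrite p_gt0 t_gt0 c_le t_col sum_t /=.
case: s => [//|[p c] t]; rewrite is_kcomposition_cons.
case/and5P=> p_gt0 /eqP -> _ t_gt0 /andP [t_col /eqP sum_t].
case: p p_gt0 sum_t => [//|[|p]] _ sum_t.
  (* The sum is at least 2, so there is a second part [q]; its colour [d] is the
     choice that was made. *)
  case: t t_gt0 t_col sum_t => [//|[q d] t] /= /andP [q_gt0 t_gt0].
  move=> /andP [/andP [d_gt0 d_le] t_col] [sum_t].
  exists ((q, 1%N) :: t, d); split; last by case: d d_gt0 {d_le}.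
    by rewrite IHn is_kcomposition_cons q_gt0 hk t_gt0 t_col -sum_t /=.
  by rewrite (mem_iota 0 k.+1).
exists ((p.+1, 1%N) :: t, 0%N); split; rewrite ?mem_iota //.
by case: sum_t => sum_t; rewrite IHn is_kcomposition_cons hk t_gt0 t_col /= -sum_t.
Qed.

Lemma size_kcomp_enum (k n : nat) : size (kcomp_enum k n) = (k.+1 ^ n)%N.
Proof.
elim: n => // n IHn.
by rewrite [LHS](size_allpairs kcomp_extend) IHn size_iota expnSr.
Qed.

(** A first part equal to [1] can only come from a positive [c], since the parts
    being enlarged are positive; the extended composition is then recovered
    because its first colour was [1]. *)
Lemma kcomp_extend_inj (k n c c' : nat) (s s' : seq (nat * nat)) :
  is_kcomposition k n.+1 s -> is_kcomposition k n.+1 s' ->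
  kcomp_extend s c = kcomp_extend s' c' -> (s, c) = (s', c').
Proof.
case: s s' => [//|[p d] t] [//|[p' d'] t']; rewrite !is_kcomposition_cons.
case/andP=> p_gt0 /andP [/eqP -> _] /andP [p'_gt0 /andP [/eqP -> _]].
case: c c' => [|c] [|c'] /= [].
- by move=> -> ->.
- by move=> p0; rewrite p0 in p_gt0.
- by move=> p'0; rewrite -p'0 in p'_gt0.
- by move=> -> -> ->.
Qed.

Lemma kcomp_enum_uniq (k n : nat) (hk : (1 <= k)%N) : uniq (kcomp_enum k n).
Proof.
elim: n => [//|n IHn]; apply: allpairs_uniq => //; first exact: iota_uniq.
move=> _ _ /allpairsP [[s c] [s_in _ ->]] /allpairsP [[s' c'] [s'_in _ ->]].
by apply: (@kcomp_extend_inj k n); rewrite -mem_kcomp_enum.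
Qed.

Lemma num_kcompositionsS (k n : nat) (hk : (1 <= k)%N) :
  num_kcompositions k n.+1 = (k.+1 ^ n)%N.
Proof.
rewrite -size_kcomp_enum /num_kcompositions.
have -> : [set s | is_kcomposition k n.+1 s]%classic
        = [set` [fset s in kcomp_enum k n]%fset]%classic.
  by apply/seteqP; split => s /=; rewrite inE mem_kcomp_enum.
by rewrite set_fsetK card_fseq undup_id // kcomp_enum_uniq.
Qed.

Section GeometricSeries.
Variable R : comUnitRingType.
Implicit Type f : fps R.

Lemma fps_coefMn f m n : fps_coef (f *+ m) n = fps_coef f n *+ m.
Proof.
elim: m => [//|m IHm]; rewrite !mulrS -IHm.
by [].
Qed.

Lemma fps_coefMXS f n : fps_coef (f * fpsX R) n.+1 = fps_coef f n.
Proof.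
rewrite mulrC /= !big_ord_recl /= mul0r add0r mul1r subSS subn0.
by rewrite big1 ?addr0 // => i _; rewrite mul0r.
Qed.

Definition geometric_fps (a : nat) : fps R :=
  fps_sum_ge1 (fun n => (a ^ n.-1)%:R).

Lemma geometric_fps_mul a :
  geometric_fps a * (1 - a%:R * fpsX R) = fpsX R.
Proof.
rewrite mulrBr mulr1 mulrCA mulr_natl.
apply: fpsP => n; rewrite [LHS]/= -/(_ * _) -/(_ *+ _).
have -> : fps_coef (geometric_fps a * fpsX R *+ a) n
        = fps_coef (geometric_fps a * fpsX R) n *+ a by exact: fps_coefMn.
case: n => [|n]; first by rewrite /= big_ord1 mul0r mul0rn subr0.
rewrite fps_coefMXS; case: n => [|n] /=; first by rewrite mul0rn subr0.
by rewrite expnSr natrM mulr_natr subrr.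
Qed.

(** The constant coefficient is 1 because [f] has none of its own. *)
Lemma fps_unit_1subMn a f : fps_coef f 0 = 0 -> 1 - a%:R * f \is a GRing.unit.
Proof.
move=> f0; rewrite mulr_natl /in_mem /= /fps_unit /=.
by have := fps_coefMn f a 0; rewrite f0 mul0rn => ->; rewrite subr0 unitr1.
Qed.

(** Since [S (1 - x) = x], the denominators are related by
    [1 - (k + 1) x = (1 - x) (1 - k S)]. Combinatorially, the left side puts a
    sequence of [k]-coloured parts behind a first part, and the right side makes
    a choice among [k + 1] extensions at each step. *)
Lemma geometric_fps_parts k :
  let S := geometric_fps 1 in
  S / (1 - k%:R * S) = fpsX R / (1 - (k + 1)%:R * fpsX R).
Proof.
move=> S.
have SX : S * (1 - fpsX R) = fpsX R.
  by rewrite -[X in _ * (1 - X)]mul1r geometric_fps_mul.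
have uS : 1 - k%:R * S \is a GRing.unit by exact: fps_unit_1subMn.
have uX : 1 - (k + 1)%:R * fpsX R \is a GRing.unit by exact: fps_unit_1subMn.
have factor : 1 - (k + 1)%:R * fpsX R = (1 - fpsX R) * (1 - k%:R * S).
  rewrite mulrBr mulr1 mulrCA [_ * S]mulrC SX natrD mulrDl mul1r opprD.
  by rewrite addrA addrAC.
by apply: (mulIr uX); rewrite divrK // factor mulrACA SX mulVr ?mulr1.
Qed.

End GeometricSeries.

Theorem proposition2 (k : nat) (hk : (1 <= k)%N) :
  let x : fps int := fpsX int in
  let S : fps int := fps_sum_ge1 (fun _ => 1) in
  [/\ fps_sum_ge1 (fun n => (num_kcompositions k n)%:R) = S / (1 - k%:R * S),
      S / (1 - k%:R * S) = x / (1 - (k + 1)%:R * x)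
    & forall n : nat, (1 <= n)%N ->
        num_kcompositions k n = ((k + 1) ^ (n - 1))%N].
Proof.
move=> x S.
have S_geom : S = geometric_fps int 1.
  by apply: fpsP => -[|n] //=; rewrite exp1n.
have S_x : S / (1 - k%:R * S) = x / (1 - (k + 1)%:R * x).
  by rewrite S_geom geometric_fps_parts.
split=> [|//|[//|n] _]; last by rewrite subSS subn0 addn1 num_kcompositionsS.
have -> : fps_sum_ge1 (fun n => (num_kcompositions k n)%:R)
        = geometric_fps int (k + 1).
  by apply: fpsP => -[|n] //=; rewrite num_kcompositionsS // addn1.
rewrite S_x -[X in _ = X / _](geometric_fps_mul _ (k + 1)) mulrK //.
exact: fps_unit_1subMn.
Qed.
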